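(* Let $\bar x\in\mathbb{R}^n$ be a local minimizer of the disjunctive problem $\min_x f(x)$ s.t. $F(x)\in\Gamma$, and let LICQ hold at $\bar x$. Then $\bar x$ is SAS-stationary and AS-regular. Particularly, $\bar x$ is S-stationary.
   Context: Here $f\colon\mathbb{R}^n\to\mathbb{R}$ and $F\colon\mathbb{R}^n\to\mathbb{R}^\ell$ are continuously differentiable, $\Gamma=\bigcup_{j=1}^t\Gamma_j$ with convex polyhedral sets $\Gamma_1,\dots,\Gamma_t\subset\mathbb{R}^\ell$, and $F'(x)$ is the Jacobian of $F$ at $x$. For a feasible point $\bar x$, $J(\bar x)=\{j\in\{1,\dots,t\}\mid F(\bar x)\in\Gamma_j\}$. For a closed set $\Omega$ and $y\in\Omega$, the regular normal cone is $\widehat N_\Omega(y)=\{\xi\mid \forall z\in\Omega\colon \xi^\top(z-y)\le o(\|z-y\|)\}$ (the convex normal cone if $\Omega$ is convex). For a set-valued map $\Upsilon$, $\limsup_{x\to\bar x}\Upsilon(x)$ is the set of all $y$ for which there exist $x^k\to\bar x$ and $y^k\to y$ with $y^k\in\Upsilon(x^k)$ for all $k$. LICQ holds at a feasible point $\bar x$ if $$F'(\bar x)^\top\lambda=0,\ \lambda\in\sum_{j\in J(\bar x)}\operatorname{span}\widehat N_{\Gamma_j}(F(\bar x))\quad\Longrightarrow\quad\lambda=0.$$ A feasible point $\bar x$ is S-stationary if there is $\lambda\in\widehat N_\Gamma(F(\bar x))$ with $0=\nabla f(\bar x)+F'(\bar x)^\top\lambda$. It is SAS-stationary if there is a sequence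 $\{(x^k,\lambda^k,\varepsilon^k)\}_{k=1}^\infty\subset\mathbb{R}^n\times\mathbb{R}^\ell\times\mathbb{R}^n$ with $(x^k,\varepsilon^k)\to(\bar x,0)$ and, for all $k$, $\varepsilon^k=\nabla f(x^k)+F'(x^k)^\top\lambda^k$ and $\lambda^k\in\widehat N_\Gamma(F(\bar x))$. It is AS-regular if $\limsup_{x\to\bar x}F'(x)^\top\widehat N_\Gamma(F(\bar x))\subset F'(\bar x)^\top\widehat N_\Gamma(F(\bar x))$. *)

(* Defs.v *)
From HB Require Import structures.
From mathcomp Require Export all_boot all_order all_algebra.
From mathcomp Require Export boolp classical_sets functions reals.
From mathcomp Require Export topology normedtype sequences derive.
Set Implicit Arguments.
Unset Strict Implicit.
Unset Printing Implicit Defensive.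
Import Order.TTheory GRing.Theory Num.Theory.
Import numFieldNormedType.Exports.
Local Open Scope classical_set_scope.
Local Open Scope ring_scope.

(* Vectors of R^m are row vectors 'rV[R]_m, as in the library's differential
   calculus. The norm on 'rV[R]_m is the sup norm; it only enters through
   topology and o(|z - y|), which do not depend on the choice of norm. *)

Definition dotr (R : realType) m (u v : 'rV[R]_m) : R :=
  \sum_(i < m) u 0 i * v 0 i.

Definition gradient (R : realType) n (f : 'rV[R]_n -> R) (x : 'rV[R]_n) :
    'rV[R]_n :=
  \row_(i < n) 'D_(delta_mx 0 i) f x.

(* The library's 'J F x acts on row vectors, v |-> v *m 'J F x, so the usual
   l x n matrix of partial derivatives is its transpose. *)
Definition jac (R : realType) n l (F : 'rV[R]_n -> 'rV[R]_l) (x : 'rV[R]_n) :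
    'M[R]_(l, n) :=
  ('J F x)^T.

(* F'(x)^T lambda, written with row vectors. *)
Definition jacT_mul (R : realType) n l (F : 'rV[R]_n -> 'rV[R]_l)
    (x : 'rV[R]_n) (lambda : 'rV[R]_l) : 'rV[R]_n :=
  lambda *m jac F x.

Definition C1_scalar (R : realType) n (f : 'rV[R]_n -> R) : Prop :=
  (forall x, differentiable f x) /\ continuous (gradient f).

Definition C1_vector (R : realType) n l (F : 'rV[R]_n -> 'rV[R]_l) : Prop :=
  (forall x, differentiable F x) /\ continuous (jac F).

Definition convex_polyhedral (R : realType) l (P : set 'rV[R]_l) : Prop :=
  exists (m : nat) (a : 'I_m -> 'rV[R]_l) (b : 'I_m -> R),
    P = [set y | forall i, dotr (a i) y <= b i].

(* Only meant for points y of Omega. *)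
Definition regular_normal_cone (R : realType) l (Omega : set 'rV[R]_l)
    (y : 'rV[R]_l) : set 'rV[R]_l :=
  [set xi | forall e : R, 0 < e ->
     \forall z \near y, Omega z -> dotr xi (z - y) <= e * `|z - y|].

Definition linear_span (R : realType) l (A : set 'rV[R]_l) : set 'rV[R]_l :=
  [set v | exists2 s : seq 'rV[R]_l,
     (forall x, x \in s -> A x) & v \in <<s>>%VS].

Definition set_limsup (R : realType) n m (Y : 'rV[R]_n -> set 'rV[R]_m)
    (xbar : 'rV[R]_n) : set 'rV[R]_m :=
  [set y | exists (x_ : nat -> 'rV[R]_n) (y_ : nat -> 'rV[R]_m),
     [/\ x_ @ \oo --> xbar, y_ @ \oo --> y & forall k, Y (x_ k) (y_ k)]].

Section disjunctive_problem.
Context (R : realType) (n l t : nat).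
Variables (f : 'rV[R]_n -> R) (F : 'rV[R]_n -> 'rV[R]_l)
  (Gamma_ : 'I_t -> set 'rV[R]_l).

Definition Gamma : set 'rV[R]_l := \bigcup_j Gamma_ j.

Definition feasible (x : 'rV[R]_n) : Prop := Gamma (F x).

Definition local_minimizer (xbar : 'rV[R]_n) : Prop :=
  feasible xbar /\ \forall x \near xbar, feasible x -> f xbar <= f x.

Definition active_index (xbar : 'rV[R]_n) : set 'I_t :=
  [set j | Gamma_ j (F xbar)].

Definition sum_span_normals (xbar : 'rV[R]_n) : set 'rV[R]_l :=
  [set lambda | exists2 mu : 'I_t -> 'rV[R]_l,
     (forall j, active_index xbar j ->
        linear_span (regular_normal_cone (Gamma_ j) (F xbar)) (mu j)) &
     lambda = \sum_(j | j \in active_index xbar) mu j].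

Definition LICQ (xbar : 'rV[R]_n) : Prop :=
  feasible xbar /\
  forall lambda, jacT_mul F xbar lambda = 0 ->
    sum_span_normals xbar lambda -> lambda = 0.

Definition S_stationary (xbar : 'rV[R]_n) : Prop :=
  feasible xbar /\
  exists2 lambda, regular_normal_cone Gamma (F xbar) lambda &
    0 = gradient f xbar + jacT_mul F xbar lambda.

Definition SAS_stationary (xbar : 'rV[R]_n) : Prop :=
  feasible xbar /\
  exists (x_ : nat -> 'rV[R]_n) (lambda_ : nat -> 'rV[R]_l)
         (eps_ : nat -> 'rV[R]_n),
    [/\ x_ @ \oo --> xbar,
        eps_ @ \oo --> (0 : 'rV[R]_n),
        forall k, eps_ k = gradient f (x_ k) + jacT_mul F (x_ k) (lambda_ k)
      & forall k, regular_normal_cone Gamma (F xbar) (lambda_ k)].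

(* The cone stays fixed at F xbar; only the Jacobian varies with x. *)
Definition AS_regular (xbar : 'rV[R]_n) : Prop :=
  feasible xbar /\
  set_limsup (fun x => jacT_mul F x @` regular_normal_cone Gamma (F xbar)) xbar
    `<=` jacT_mul F xbar @` regular_normal_cone Gamma (F xbar).

End disjunctive_problem.

(* Main.v *)
Require Import Defs.
From mathcomp Require Import lra.
Import Order.TTheory GRing.Theory Num.Theory.
Import numFieldNormedType.Exports.
Local Open Scope classical_set_scope.
Local Open Scope ring_scope.

(** Write [A] for the Jacobian of [F] at [xbar] and [S] for the sum of the
spans of the normal cones to the active pieces [Gamma_ j]. LICQ says that
[u |-> u *m A] is injective on the linear subspace [S].

Stability ([cvg_multipliers]). An injective linear map on a finite-dimensional
space has a left inverse, so it is bounded below, and so are its small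
perturbations. Therefore, if [x_ k] tends to [xbar] and the [u_ k] in [S] have
convergent images under the Jacobians at [x_ k], then the [u_ k] converge
themselves. Since normal cones are closed, AS-regularity follows at once: the
normal cone to the union lies in the one to any active piece, hence in [S].

Stationarity for one piece ([approximate_KKT], [KKT_active]). The point [xbar]
is a local minimizer of [f] under the constraint that [F x] lies in the
polyhedron [Gamma_ j], for every active [j]. Minimizing a quadratic penalty
function over a small closed ball yields points arbitrarily close to [xbar] at
which the multiplier equation holds up to a small error; the multipliers are
nonnegative combinations of the rows of the active inequalities, so they are
normal to the polyhedron at [F xbar]. Stability lets them converge to an exact
multiplier.

Stationarity for the union. Two multipliers belonging to two active pieces have
the same image under the Jacobian and both lie in [S], so they are equal. The
common value is normal to all active pieces, hence to the union, because the
inactive pieces, being closed, stay away from [F xbar]. That is S-stationarity,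
and constant sequences give SAS-stationarity. *)

Set Implicit Arguments.
Unset Strict Implicit.

(** * Convergence and norms of matrices *)

Lemma coord_le_norm (R : realType) m n (M : 'M[R]_(m, n)) i j :
  `|M i j| <= `|M|.
Proof.
rewrite [leRHS]/Num.Def.normr/= mx_normrE.
exact: (le_bigmax _ (fun ij : 'I_m * 'I_n => `|M ij.1 ij.2|) (i, j)).
Qed.

Lemma norm_le_coord (R : realType) m n (M : 'M[R]_(m, n)) (c : R) :
  0 <= c -> (forall i j, `|M i j| <= c) -> `|M| <= c.
Proof.
move=> c0 Mc; rewrite /Num.Def.normr/= mx_normrE.
by apply: (bigmax_le _ c0) => -[i j] _ /=.
Qed.

Lemma cvg_mxP (R : realType) (I : Type) (F : set_system I) (FF : Filter F)
    m n (u : I -> 'M[R]_(m, n)) (M : 'M[R]_(m, n)) :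
  u @ F --> M <-> forall i j, (fun k => u k i j) @ F --> M i j.
Proof.
split=> [uM i j|uM].
  exact: (cvg_comp _ _ uM (@coord_continuous _ _ _ i j M)).
apply/cvgrPdist_le => e e0.
have : \forall k \near F, forall ij : 'I_m * 'I_n,
    `|M ij.1 ij.2 - u k ij.1 ij.2| <= e.
  by apply: filter_forall => -[i j]; move/cvgrPdist_le: (uM i j); apply.
apply: filterS => k uk; apply: norm_le_coord (ltW e0) _ => i j.
by rewrite !mxE; exact: uk (i, j).
Qed.

Lemma cvg_mulmx (R : realType) (I : Type) (F : set_system I) (FF : Filter F)
    m n p (u : I -> 'M[R]_(m, n)) (v : I -> 'M[R]_(n, p))
    (M : 'M[R]_(m, n)) (N : 'M[R]_(n, p)) :
  u @ F --> M -> v @ F --> N -> (fun k => u k *m v k) @ F --> M *m N.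
Proof.
move=> /cvg_mxP uM /cvg_mxP vN; apply/cvg_mxP => i j; rewrite mxE.
under eq_fun do rewrite mxE.
apply: cvg_big => [|k _]; first exact: add_continuous.
exact: cvgM.
Qed.

(** The factor [n] is there because the sup norm is not submultiplicative. *)
Lemma norm_mulmx (R : realType) m n p (M : 'M[R]_(m, n)) (N : 'M[R]_(n, p)) :
  `|M *m N| <= n%:R * (`|M| * `|N|).
Proof.
apply: norm_le_coord => [|i j]; first by rewrite !mulr_ge0.
rewrite mxE (le_trans (ler_norm_sum _ _ _))// mulr_natl.
rewrite -[leRHS](_ : \sum_(k < n) `|M| * `|N| = _); last first.
  by rewrite sumr_const card_ord.
by apply: ler_sum => k _; rewrite normrM ler_pM// coord_le_norm.
Qed.

(** * Multipliers under an injective linear map *)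

(** A matrix of maximal rank among those with all rows in [S] spans [S]: a
vector of [S] outside its row space would give a matrix of larger rank. *)
Lemma linear_set_mx (R : realType) l (S : set 'rV[R]_l) :
  S 0 -> (forall (c : R) u v, S u -> S v -> S (c *: u + v)) ->
  exists U : 'M[R]_l, forall u, S u <-> (u <= U)%MS.
Proof.
move=> S0 SL.
have subS m (W : 'M[R]_(m, l)) : (forall i, S (row i W)) ->
    forall u, (u <= W)%MS -> S u.
  move=> WS u /submxP[c ->]; rewrite mulmx_sum_row.
  elim/big_ind: _ => // [x y Sx Sy|i _].
    by rewrite -[x]scale1r; exact: SL.
  by rewrite -[_ *: _]addr0; exact: SL.
pose P r := `[< exists U : 'M[R]_l,
  \rank U = r /\ forall u, (u <= U)%MS -> S u >].
have P0 : exists r, P r.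
  exists 0%N; apply/asboolP; exists 0; split; first exact: mxrank0.
  by move=> u; rewrite submx0 => /eqP->.
have Pl r : P r -> (r <= l)%N.
  by move=> /asboolP[U [<- _]]; exact: rank_leq_row.
case: (ex_maxnP P0 Pl) => r /asboolP[U [rU US]] rmax.
exists U => u; split => [Su|]; last exact: US.
have /rmax : P (\rank (U + u)%MS).
  apply/asboolP; exists (U + u)%MS; split => // w /sub_addsmxP[[c1 c2] /= ->].
  rewrite -[c1 *m U]scale1r; apply: SL; first exact/US/submxMl.
  have uS i : S (row i u) by rewrite row_id.
  exact: (subS _ u uS _ (submxMl _ _)).
rewrite -rU => le.
have := mxrank_leqif_sup (addsmxSl U u).
rewrite /leqif eqn_leq le mxrankS ?addsmxSl//=.
by move=> [_ /esym]; rewrite addsmx_sub => /andP[].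
Qed.

Lemma left_inverse_on (R : realType) l n (S : set 'rV[R]_l)
    (A : 'M[R]_(l, n)) :
  S 0 -> (forall (c : R) u v, S u -> S v -> S (c *: u + v)) ->
  (forall u, u *m A = 0 -> S u -> u = 0) ->
  exists B : 'M[R]_(n, l), forall u, S u -> u *m A *m B = u.
Proof.
move=> S0 SL injA; have [U SU] := linear_set_mx S0 SL.
pose W := row_base U.
have freeWA : row_free (W *m A).
  rewrite -kermx_eq0; apply/rowV0P => c /sub_kermxP; rewrite mulmxA => cWA.
  have /(injA _ cWA) cW : S (c *m W).
    by apply/SU; rewrite (submx_trans (submxMl _ _))// eq_row_base.
  by apply: (row_free_inj (row_base_free U)); rewrite mul0mx.
exists (pinvmx (W *m A) *m W) => u /SU.
rewrite -(eq_row_base U) => /submxP[c ->].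
by rewrite -/W -(mulmxA c) [LHS]mulmxA mulmxKp.
Qed.

(** With a left inverse [B] of [A] on [S], each [u k] equals
[u k *m M k *m B - u k *m E k], where [E k := (M k - A) *m B] tends to [0].
Absorbing the last term bounds [u k] by a multiple of the convergent
[u k *m M k *m B]; then the last term tends to [0] as well. *)
Lemma cvg_multipliers (R : realType) (I : Type) (F : set_system I)
    (FF : ProperFilter F) l n (S : set 'rV[R]_l) (A : 'M[R]_(l, n))
    (u : I -> 'rV[R]_l) (M : I -> 'M[R]_(l, n)) (y : 'rV[R]_n) :
  S 0 -> (forall (c : R) u v, S u -> S v -> S (c *: u + v)) ->
  (forall u, u *m A = 0 -> S u -> u = 0) ->
  (forall k, S (u k)) -> M @ F --> A -> (fun k => u k *m M k) @ F --> y ->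
  exists2 x : 'rV[R]_l, u @ F --> x & x *m A = y.
Proof.
move=> S0 SL injA Su MA uMy.
have [B AB] := left_inverse_on S0 SL injA.
pose E k := (M k - A) *m B.
have E0 : E @ F --> (0 : 'M[R]_l).
  rewrite -(mul0mx _ B) -(subrr A); apply: cvg_mulmx; last exact: cvg_cst.
  by apply: cvgB => //; exact: cvg_cst.
pose w k := u k *m M k *m B.
have wy : w @ F --> y *m B by apply: cvg_mulmx => //; exact: cvg_cst.
have uE k : u k = w k - u k *m E k.
  by rewrite /w /E mulmxA mulmxBr mulmxBl AB// opprB addrC subrK.
have uw : \forall k \near F, `|u k| <= 2 * `|w k|.
  (* [l.+1] rather than [l], so that the threshold makes sense for [l = 0] *)
  have l1 : 0 < (2 * l.+1%:R : R)^-1 by rewrite invr_gt0 mulr_gt0.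
  near=> k.
  have : `|u k| <= `|w k| + l%:R * (`|u k| * `|E k|).
    by rewrite {1}uE (le_trans (ler_normB _ _))// lerD2l norm_mulmx.
  have : l%:R * (`|u k| * `|E k|) <= 2^-1 * `|u k|.
    rewrite mulrCA mulrC; apply: ler_wpM2r => //.
    have : `|E k| <= (2 * l.+1%:R : R)^-1.
      by near: k; exact: (cvgr0_norm_le _ E0).
    move=> le; apply: le_trans (_ : l.+1%:R * `|E k| <= _).
      by rewrite ler_wpM2r// ler_nat.
    have -> : 2^-1 = l.+1%:R * (2 * l.+1%:R)^-1 :> R.
      by rewrite invfM mulrCA mulfV ?mulr1// pnatr_eq0.
    by rewrite ler_wpM2l.
  lra.
have uE0 : (fun k => u k *m E k) @ F --> (0 : 'rV[R]_l).
  apply/norm_cvg0P.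
  pose g k : R := l%:R * (2 * `|w k| * `|E k|).
  apply: (@squeeze_cvgr _ _ _ _ (fun=> 0) g).
  - near=> k; rewrite normr_ge0/= (le_trans (norm_mulmx _ _))// ler_wpM2l//.
    by rewrite ler_wpM2r//; near: k.
  - exact: cvg_cst.
  - rewrite -(mulr0 l%:R); apply: cvgM; first exact: cvg_cst.
    rewrite -(mulr0 (2 * `|y *m B|)) -[X in _ * X](@normr0 _ 'M[R]_l).
    apply: cvgM; last exact: cvg_norm.
    by apply: cvgM; [exact: cvg_cst|exact: cvg_norm].
have ux : u @ F --> y *m B.
  rewrite (_ : u = fun k => w k - u k *m E k); last exact/funext.
  by rewrite -[X in _ --> X]subr0; exact: cvgB.
exists (y *m B) => //.
have uMA : (fun k => u k *m M k) @ F --> y *m B *m A by apply: cvg_mulmx.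
apply: (@cvg_unique 'rV[R]_n (@norm_hausdorff _ _) _ _ _ _ _ uMy).
exact: uMA.
Unshelve. all: by end_near. Qed.

(** * Normal cones *)

Lemma dotrDl (R : realType) m (u v w : 'rV[R]_m) :
  dotr (u + v) w = dotr u w + dotr v w.
Proof.
by rewrite /dotr -big_split/=; apply: eq_bigr => i _; rewrite mxE mulrDl.
Qed.

Lemma dotrBr (R : realType) m (u v w : 'rV[R]_m) :
  dotr u (v - w) = dotr u v - dotr u w.
Proof.
by rewrite /dotr -sumrB; apply: eq_bigr => i _; rewrite !mxE mulrBr.
Qed.

Lemma dotr_suml (R : realType) m p (c : 'I_p -> R) (u : 'I_p -> 'rV[R]_m) w :
  dotr (\sum_i c i *: u i) w = \sum_i c i * dotr (u i) w.
Proof.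
rewrite /dotr; under [RHS]eq_bigr do rewrite mulr_sumr.
rewrite exchange_big/=; apply: eq_bigr => i _; rewrite summxE mulr_suml.
by apply: eq_bigr => j _; rewrite mxE mulrA.
Qed.

Lemma dotr_continuous (R : realType) m (a : 'rV[R]_m) : continuous (dotr a).
Proof.
apply: continuous_big => [|i _ y]; first exact: add_continuous.
apply: (@cvgM R _ (nbhs y) _ (fun=> a 0 i) (fun z : 'rV[R]_m => z 0 i)).
  exact: cvg_cst.
exact: coord_continuous.
Qed.

Lemma norm_dotr (R : realType) m (u v : 'rV[R]_m) :
  `|dotr u v| <= m%:R * (`|u| * `|v|).
Proof.
rewrite (le_trans (ler_norm_sum _ _ _))// mulr_natl.
rewrite -[leRHS](_ : \sum_(k < m) `|u| * `|v| = _); last first.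
  by rewrite sumr_const card_ord.
by apply: ler_sum => k _; rewrite normrM ler_pM// coord_le_norm.
Qed.

(** Half of the tolerance [e] is spent on replacing [u] by a close [u_ k], the
other half on the normality of that [u_ k]. *)
Lemma regular_normal_cone_cvg (R : realType) l (Omega : set 'rV[R]_l) y
    (u_ : nat -> 'rV[R]_l) u :
  (forall k, regular_normal_cone Omega y (u_ k)) -> u_ @ \oo --> u ->
  regular_normal_cone Omega y u.
Proof.
move=> Nu uu e e0.
have d0 : 0 < e / (2 * l.+1%:R) by rewrite divr_gt0// mulr_gt0.
near \oo => k.
have uk : `|u - u_ k| <= e / (2 * l.+1%:R).
  by near: k; move/cvgrPdist_le : uu; apply.
have /(Nu k) : 0 < e / 2 by rewrite divr_gt0.
apply: filterS => z /[apply] zN.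
rewrite -(subrK (u_ k) u) dotrDl (splitr e) mulrDl.
rewrite lerD// (le_trans (ler_norm _))// (le_trans (norm_dotr _ _))// mulrA.
rewrite ler_wpM2r// (@le_trans _ _ (l.+1%:R * (e / (2 * l.+1%:R))))//.
  by rewrite ler_pM// ler_nat.
by rewrite mulrC invfM mulrA mulfVK// pnatr_eq0.
Unshelve. all: by end_near. Qed.

Lemma regular_normal_coneS (R : realType) l (A B : set 'rV[R]_l) y :
  A `<=` B -> regular_normal_cone B y `<=` regular_normal_cone A y.
Proof. by move=> AB xi N e /N; apply: filterS => z + /AB. Qed.

(** Near [y], a finite union of closed sets consists of points of the pieces
that contain [y], so only these pieces constrain the normals. *)
Lemma regular_normal_cone_bigcup (R : realType) l t
    (Gamma_ : 'I_t -> set 'rV[R]_l) (y xi : 'rV[R]_l) :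
  (forall j, closed (Gamma_ j)) ->
  (forall j, Gamma_ j y -> regular_normal_cone (Gamma_ j) y xi) ->
  regular_normal_cone (Gamma Gamma_) y xi.
Proof.
move=> clG NG e e0.
have : \forall z \near y,
    forall j, Gamma_ j z -> dotr xi (z - y) <= e * `|z - y|.
  apply: (@filter_forall _ _ _ (nbhs y) (nbhs_filter y)) => j.
  have [Gy|NGy] := pselect (Gamma_ j y); first exact: NG.
  have := @open_nbhs_nbhs _ y (~` Gamma_ j).
  move=> /(_ (conj (closed_openC (clG j)) NGy)).
  by apply: filterS => z.
by apply: filterS => z H [j _]; exact: H.
Qed.

(** The second hypothesis is complementary slackness: for [y] in the polyhedron
it allows nonzero weights on active inequalities only. *)
Lemma polyhedral_normal (R : realType) l m (a : 'I_m -> 'rV[R]_l)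
    (b c : 'I_m -> R) y :
  (forall i, 0 <= c i) -> (forall i, c i != 0 -> b i <= dotr (a i) y) ->
  regular_normal_cone [set z | forall i, dotr (a i) z <= b i] y
    (\sum_i c i *: a i).
Proof.
move=> c0 cb e e0; near=> z => zP.
apply: (@le_trans _ _ 0); last by rewrite mulr_ge0// ltW.
rewrite dotr_suml sumr_le0// => i _.
have [->|ci] := eqVneq (c i) 0; first by rewrite mul0r.
by rewrite mulr_ge0_le0// dotrBr subr_le0 (le_trans (zP i))// cb.
Unshelve. all: by end_near. Qed.

Lemma closed_polyhedral (R : realType) l (P : set 'rV[R]_l) :
  convex_polyhedral P -> closed P.
Proof.
move=> [m [a [b ->]]].
rewrite (_ : [set _ | _] =
    \bigcap_i (dotr (a i) @^-1` [set s | s <= b i])); last first.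
  by apply/seteqP; split=> [z zP i _|z zP i]; [exact: zP|exact: (zP i Logic.I)].
apply: closed_bigI => i _; apply: closed_comp; last exact: closed_le.
by move=> z _; exact: dotr_continuous.
Qed.

(** * Directional derivatives *)

(** The difference quotients are nonnegative on the right of [0] and
nonpositive on the left. *)
Lemma derive_at_local_min (R : realType) n (psi : 'rV[R]_n -> R) x v (d : R) :
  is_derive x v psi d -> (\forall y \near x, psi x <= psi y) -> d = 0.
Proof.
move=> psid xmin.
pose q (h : R) : R := h^-1 * (psi (h *: v + x) - psi x).
have dP : q @ 0^' --> d.
  rewrite -(@derive_val _ _ _ _ _ _ _ psid).
  exact: (@ex_derive _ _ _ _ _ _ _ psid).
have nmin : \forall h \near (0 : R), psi x <= psi (h *: v + x).
  have : (fun h : R => h *: v + x) @ (0 : R) --> x.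
    rewrite -[X in _ --> X]add0r -(scale0r v).
    apply: cvgD; last exact: cvg_cst.
    by apply: cvgZ; [exact: cvg_id|exact: cvg_cst].
  by move=> /(_ _ xmin).
apply/eqP; rewrite eq_le; apply/andP; split.
- apply: (@closed_cvg _ R _ _ q _ (@closed_le R 0) _ d
    (cvg_dnbhs_at_left dP)).
  near=> h; rewrite /= /q mulrC mulr_ge0_le0//.
    by rewrite subr_ge0; near: h; exact: cvg_within nmin.
  by rewrite invr_le0; near: h; exact: nbhs_left_le.
- apply: (@closed_cvg _ R _ _ q _ (@closed_ge R 0) _ d
    (cvg_dnbhs_at_right dP)).
  near=> h; rewrite /= /q mulr_ge0//.
    by rewrite invr_ge0; near: h; exact: nbhs_right_ge.
  by rewrite subr_ge0; near: h; exact: cvg_within nmin.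
Unshelve. all: by end_near. Qed.

Lemma is_derive_fsum (R : realType) n (J : nat) (h : 'I_J -> 'rV[R]_n -> R)
    x v dh :
  (forall i, is_derive x v (h i) (dh i)) ->
  is_derive x v (fun y => \sum_i h i y) (\sum_i dh i).
Proof. by move=> /is_derive_sum; rewrite fct_sumE. Qed.

Lemma is_derive_sqr (R : realType) n (u : 'rV[R]_n -> R) x v du :
  is_derive x v u du -> is_derive x v (fun y => u y ^+ 2) (2 * u x * du).
Proof.
move=> ud.
have := @is_deriveX _ _ u 2 x v du ud.
by rewrite exprfctE.
Qed.

Lemma is_derive_coord (R : realType) n (x v : 'rV[R]_n) i :
  is_derive x v (fun y : 'rV[R]_n => y 0 i) (v 0 i).
Proof.
have Did : derivable (@id 'rV[R]_n) x v by exact: derivable_id.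
rewrite -[in v 0 i](derive_id x v) (derive_mx Did) mxE; apply: derivableP.
exact: (derivable_mxP _ x v).1.
Qed.

Lemma is_derive_affine_comp (R : realType) n l (F : 'rV[R]_n -> 'rV[R]_l)
    a c x v :
  differentiable F x ->
  is_derive x v (fun y => dotr a (F y) - c) (dotr a (v *m 'J F x)).
Proof.
move=> dF; have DF := diff_derivable (v := v) dF.
apply: (@is_derive_eq _ _ _ _ _ _ _ (dotr a (v *m 'J F x) - 0)).
  apply: (@is_deriveB _ _ _ (fun y => dotr a (F y)) (cst c)).
  apply: is_derive_fsum => i.
  rewrite -deriveEjacobian// (derive_mx DF) mxE.
  apply: (@is_deriveZ _ _ _ (fun y => F y 0 i)); apply: derivableP.
  exact: (derivable_mxP F x v).1.
by rewrite subr0.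
Qed.

Lemma jacT_mulE (R : realType) n l (F : 'rV[R]_n -> 'rV[R]_l) x lambda j :
  jacT_mul F x lambda 0 j = dotr lambda (delta_mx 0 j *m 'J F x).
Proof.
by rewrite -rowE /jacT_mul /jac mxE; apply: eq_bigr => i _; rewrite !mxE.
Qed.

(** * The penalty method *)

(** Near a point where [p] vanishes, [c < g] alone does the job for all
weights; near any other point [p] is bounded away from [0], and all large
weights work. By compactness finitely many such neighborhoods suffice. *)
Lemma compact_penalty (R : realType) (T : topologicalType) (K : set T)
    (g p : T -> R) (c : R) :
  compact K -> continuous g -> continuous p -> (forall x, 0 <= p x) ->
  (forall x, K x -> p x = 0 -> c < g x) ->
  exists2 k : R, 0 <= k & forall x, K x -> c < g x + k * p x.
Proof.
move=> /compact_near_coveringP cK cg cp p0 gp.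
have /cK : forall x, K x ->
    \forall x' \near x & k \near \oo, c < g x' + k%:R * p x'.
  move=> x Kx; have [px|px] := eqVneq (p x) 0.
    exists ([set x' | c < g x'], setT) => /=.
      split; last exact: filterT.
      exact: (cvgr_gt (g x) (cg x)) (gp _ Kx px).
    by move=> [x' k] [/= cgx _]; rewrite (lt_le_trans cgx)// lerDl mulr_ge0.
  have px0 : 0 < p x by rewrite lt_neqAle eq_sym px p0.
  exists ([set x' | g x - 1 < g x' /\ p x / 2 < p x'],
      [set k | (c - (g x - 1)) / (p x / 2) < k%:R]) => /=.
    split; last exact: nbhs_infty_gtr.
    apply: filterI; first by apply: (cvgr_gt (g x) (cg x)); lra.
    by apply: (cvgr_gt (p x) (cp x)); lra.
  move=> [x' k] [/= [gx' px'] kx].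
  have p2 : 0 < p x / 2 by rewrite divr_gt0.
  rewrite ltr_pdivrMr// in kx.
  have : k%:R * (p x / 2) <= k%:R * p x' by rewrite ler_wpM2l// ltW.
  lra.
move=> H; near \oo => k; exists k%:R => // x Kx.
by move: x Kx; near: k.
Unshelve. all: by end_near. Qed.

(** The function [s |-> Num.max 0 s ^+ 2] is the squared distance from [s] to
the half-line of nonpositive numbers, hence at most the squared distance to the
point [Num.min 0 s0] of that half-line. By [sub_min0] both agree at [s0]. *)
Lemma sqr_pos_part_le (R : realType) (s s0 : R) :
  Num.max 0 s ^+ 2 <= (s - Num.min 0 s0) ^+ 2.
Proof.
have m0 : Num.min 0 s0 <= 0 by rewrite ge_min lexx.
move: (Num.min _ _) m0 => m m0.
have [s_le0|s_gt0] := leP s 0; first by rewrite expr0n sqr_ge0.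
by rewrite ler_sqr ?nnegrE; lra.
Qed.

Lemma sub_min0 (R : realType) (s : R) : s - Num.min 0 s = Num.max 0 s.
Proof.
by rewrite /Num.max /Num.min; case: ltP => _; rewrite ?subr0 ?subrr.
Qed.

(** The point [x] minimizes [f], plus the squared Euclidean distance to [xbar],
plus [k] times the sum of the squared constraint violations, over a small
closed ball around [xbar]. For [k] large the values on the bounding sphere
exceed the value at [xbar] ([compact_penalty]), so [x] is an interior point and
the derivative vanishes there. The multiplier of the [i]-th inequality is [2 k]
times its violation at [x]; on a small ball only inequalities that are active
at [F xbar] can be violated. *)
Lemma approximate_KKT (R : realType) n l m (f : 'rV[R]_n -> R)
    (F : 'rV[R]_n -> 'rV[R]_l) (a : 'I_m -> 'rV[R]_l) (b : 'I_m -> R)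
    xbar (e : R) :
  (forall x, differentiable f x) -> (forall x, differentiable F x) ->
  let P := [set z | forall i, dotr (a i) z <= b i] in
  P (F xbar) -> (\forall x \near xbar, P (F x) -> f xbar <= f x) -> 0 < e ->
  exists x lambda,
    [/\ `|x - xbar| < e, regular_normal_cone P (F xbar) lambda &
        gradient f x + jacT_mul F x lambda = - 2 *: (x - xbar)].
Proof.
move=> df dF P Pxbar xmin e0.
pose u i x : R := dotr (a i) (F x) - b i.
have cf : continuous f by move=> x; exact/differentiable_continuous.
have cu i : continuous (u i).
  move=> x; apply: (@cvgB _ _ _ (nbhs x) _ (dotr (a i) \o F) (cst (b i))).
    apply: continuous_comp; last exact: dotr_continuous.
    exact/differentiable_continuous.
  exact: cvg_cst.
pose pen x : R := \sum_i Num.max 0 (u i x) ^+ 2.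
have cpen : continuous pen.
  apply: continuous_big => [|i _ x]; first exact: add_continuous.
  apply: (@cvgM _ _ (nbhs x));
  exact: (@continuous_max _ _ (cst 0) (u i) x (@cst_continuous _ _ _ _)
    (cu i x)).
pose q (x : 'rV[R]_n) : R := \sum_j (x 0 j - xbar 0 j) ^+ 2.
have cq : continuous q.
  apply: continuous_big => [|i _ x]; first exact: add_continuous.
  have ci : (fun y : 'rV[R]_n => y 0 i - xbar 0 i) @ x --> x 0 i - xbar 0 i.
    apply: (@cvgB _ _ _ (nbhs x) _ (fun y : 'rV[R]_n => y 0 i)
      (cst (xbar 0 i))).
      exact: coord_continuous.
    exact: cvg_cst.
  exact: (@cvgM _ _ (nbhs x) _ _ _ _ _ ci ci).
have q0 x : 0 <= q x by apply: sumr_ge0 => j _; rewrite sqr_ge0.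
have q_gt0 x : x != xbar -> 0 < q x.
  move=> xx; rewrite lt_neqAle q0 andbT eq_sym.
  apply: contra xx => /eqP/psumr_eq0P qx; apply/eqP/rowP => j.
  apply/eqP; rewrite -subr_eq0 -sqrf_eq0 qx// => i _; exact: sqr_ge0.
have pen0 x : 0 <= pen x by apply: sumr_ge0 => i _; rewrite sqr_ge0.
have penP x : pen x = 0 -> P (F x).
  move=> /psumr_eq0P px i; have /eqP := px (fun i _ => sqr_ge0 _) i isT.
  rewrite sqrf_eq0 => /eqP mu; rewrite -subr_le0 -/(u i x) -mu le_max lexx.
  by rewrite orbT.
have qxbar : q xbar = 0.
  by apply: big1 => j _; rewrite subrr expr0n.
have penxbar : pen xbar = 0.
  by apply: big1 => i _; rewrite max_l ?expr0n// /u subr_le0; exact: Pxbar.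
have inact : \forall x \near xbar, forall i, u i xbar < 0 -> u i x < 0.
  apply: (@filter_forall _ _ _ (nbhs xbar) (nbhs_filter xbar)) => i.
  have [ui|ui] := ltP (u i xbar) 0; last by near=> x.
  by near=> x => _; near: x; exact: (cvgr_lt (u i xbar) (cu i xbar)).
have near_e : \forall x \near xbar, `|xbar - x| < e.
  by apply/nbhs_normP; exists e.
have : \forall x \near xbar, [/\ P (F x) -> f xbar <= f x,
    forall i, u i xbar < 0 -> u i x < 0 & `|x - xbar| < e].
  by near=> x; split; [near: x|near: x|rewrite distrC; near: x].
move=> /nbhs_normP[r' /= r'0 r'P].
(* halved, because the closed ball [K] has to fit into the open one *)
pose r := r' / 2; have r0 : 0 < r by rewrite divr_gt0.
pose K := closed_ball_ Num.norm xbar r.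
have KP x : K x -> [/\ P (F x) -> f xbar <= f x,
    forall i, u i xbar < 0 -> u i x < 0 & `|x - xbar| < e].
  by move=> Kx; apply: r'P; rewrite /= (le_lt_trans Kx)// /r; lra.
have cK : compact K.
  apply: bounded_closed_compact; last exact: closed_closed_ball_.
  exists (`|xbar| + r); split; first exact: num_real.
  move=> M rM x; rewrite /K /closed_ball_ /= => xr.
  rewrite (le_trans _ (ltW rM))// -(subrK xbar x) addrC.
  by rewrite (le_trans (ler_normD _ _))// lerD2l distrC.
pose S := [set x | `|xbar - x| = r].
have SK : S `<=` K by move=> x; rewrite /S /K /closed_ball_ /= => ->.
have cS : compact S.
  apply: (subclosed_compact _ cK SK).
  change (closed ((fun x => `|xbar - x|) @^-1` [set s | s = r])).
  apply: closed_comp; last exact: closed_eq.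
  move=> x _; have cx : (fun y => xbar - y) @ x --> xbar - x.
    apply: (@cvgB _ _ _ (nbhs x) (nbhs_filter x) (cst xbar) id).
      exact: cvg_cst.
    exact: cvg_id.
  exact: cvg_norm cx.
have [k k0 kS] : exists2 k : R, 0 <= k &
    forall x, S x -> f xbar < (f x + q x) + k * pen x.
  apply: compact_penalty => //.
    by move=> x; apply: (@cvgD _ _ _ (nbhs x)); [exact: cf|exact: cq].
  move=> x Sx /penP PFx; have [+ _ _] := KP _ (SK _ Sx).
  move=> /(_ PFx) fx; rewrite (le_lt_trans fx)// ltrDl q_gt0//.
  apply: contraPneq Sx => ->; rewrite /S /= subrr normr0.
  by apply/eqP; rewrite lt_eqF.
pose phi x : R := (f x + q x) + k * pen x.
have cphi : continuous phi.
  move=> x; apply: (@cvgD _ _ _ (nbhs x)).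
    by apply: (@cvgD _ _ _ (nbhs x)); [exact: cf|exact: cq].
  by apply: (@cvgM _ _ (nbhs x)); [exact: cvg_cst|exact: cpen].
have Kxbar : K xbar by rewrite /K /closed_ball_ /= subrr normr0 ltW.
have K0 : K !=set0 by exists xbar.
have cphiK : {within K, continuous phi} by apply: continuous_subspaceT cphi.
have [x + xphi] := EVT_min_rV K0 cK cphiK.
rewrite inE => Kx.
have phixbar : phi x <= f xbar.
  have := xphi xbar; rewrite inE => /(_ Kxbar).
  by rewrite /phi qxbar penxbar mulr0 !addr0.
have xr : `|xbar - x| < r.
  rewrite lt_neqAle Kx andbT; apply/eqP => /kS.
  by rewrite ltNge phixbar.
have phimin : \forall y \near x, phi x <= phi y.
  have : \forall y \near x, `|xbar - y| < r.
    apply/nbhs_normP; exists (r - `|xbar - x|); first by rewrite /= subr_gt0.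
    move=> y /= xy; rewrite -(subrKA x) (le_lt_trans (ler_normD _ _))//.
    by rewrite addrC -ltrBrDr.
  by apply: filterS => y xy; apply: xphi; rewrite inE; exact: ltW.
(* The differentiable majorant [psi] of [phi] touches [phi] at [x], so [x] is a
   local minimizer of [psi] too; its derivative replaces that of the squared
   positive parts. *)
pose c i := Num.min 0 (u i x).
pose psi (y : 'rV[R]_n) : R := (f y + \sum_j (y 0 j - xbar 0 j) ^+ 2) +
  k * \sum_i (u i y - c i) ^+ 2.
have psimin : \forall y \near x, psi x <= psi y.
  have psix : psi x = phi x.
    rewrite /psi /phi; congr (_ + _ * _); apply: eq_bigr => i _.
    by rewrite /c sub_min0.
  apply: filterS phimin => y; rewrite psix => /le_trans; apply.
  by rewrite lerD2l ler_wpM2l// ler_sum// => i _; exact: sqr_pos_part_le.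
have [_ uact xe] := KP _ Kx.
exists x, (\sum_i (k * (2 * Num.max 0 (u i x))) *: a i); split => //.
  apply: polyhedral_normal => i; first by rewrite !mulr_ge0// le_max lexx.
  move=> ci; rewrite -subr_ge0 leNgt; apply: contra ci => /uact ui.
  by rewrite max_l ?mulr0// ltW.
apply/rowP => j.
pose v : 'rV[R]_n := delta_mx 0 j.
pose d : R := ('D_v f x + \sum_h (2 * (x 0 h - xbar 0 h) * v 0 h)) +
   k * \sum_i (2 * (u i x - c i) * dotr (a i) (v *m 'J F x)).
have psid : is_derive x v psi d.
  apply: (@is_deriveD _ _ _ (fun y => f y + _) (fun y => k * _)).
    apply: (@is_deriveD _ _ _ f).
      by apply: derivableP; exact: diff_derivable.
    apply: is_derive_fsum => h; apply: is_derive_sqr.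
    apply: (@is_derive_eq _ _ _ _ _ _ _ (v 0 h - 0)); last by rewrite subr0.
    apply: (@is_deriveB _ _ _ (fun y : 'rV[R]_n => y 0 h) (cst (xbar 0 h))).
    exact: is_derive_coord.
  apply: (@is_deriveZ _ _ _ (fun y => \sum_i (u i y - c i) ^+ 2)).
  apply: is_derive_fsum => i; apply: is_derive_sqr.
  rewrite (_ : (fun y => _) = (fun y => dotr (a i) (F y) - (b i + c i))).
    exact: is_derive_affine_comp.
  by apply/funext => y; rewrite /u opprD addrA.
have d0 : d = 0 := derive_at_local_min psid psimin.
rewrite mxE jacT_mulE -/v dotr_suml [gradient f x 0 j]mxE -/v.
rewrite [RHS]mxE [(x - xbar) 0 j]mxE [(- xbar) 0 j]mxE.
move: d0; rewrite /d (bigD1 j)//= big1 => [|h hj]; last first.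
  by rewrite /v !mxE (negbTE hj) andbF mulr0.
rewrite [v 0 j]mxE !eqxx mulr1 addr0 mulr_sumr.
rewrite (_ : \sum_i k * _ = \sum_i k * (2 * Num.max 0 (u i x)) *
    dotr (a i) (v *m 'J F x)); last first.
  by apply: eq_bigr => i _; rewrite /c sub_min0 !mulrA.
lra.
Unshelve. all: by end_near. Qed.

(** * The subspace of LICQ *)

Lemma linear_span0 (R : realType) l (A : set 'rV[R]_l) : linear_span A 0.
Proof. by exists [::] => //; exact: mem0v. Qed.

Lemma linear_spanP (R : realType) l (A : set 'rV[R]_l) (c : R) u v :
  linear_span A u -> linear_span A v -> linear_span A (c *: u + v).
Proof.
move=> [s sA us] [s' s'A vs']; exists (s ++ s').
  by move=> x; rewrite mem_cat => /orP[/sA|/s'A].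
by rewrite span_cat memv_add// memvZ.
Qed.

Lemma linear_span_sub (R : realType) l (A : set 'rV[R]_l) :
  A `<=` linear_span A.
Proof.
move=> u Au; exists [:: u]; last by rewrite memv_span// mem_head.
by move=> x; rewrite inE => /eqP->.
Qed.

Section sum_span_normals.
Variables (R : realType) (n l t : nat) (F : 'rV[R]_n -> 'rV[R]_l)
  (Gamma_ : 'I_t -> set 'rV[R]_l) (xbar : 'rV[R]_n).

Lemma sum_span_normals0 : sum_span_normals F Gamma_ xbar 0.
Proof. by exists (fun=> 0) => [j _|]; [exact: linear_span0|rewrite big1]. Qed.

Lemma sum_span_normalsP (c : R) u v :
  sum_span_normals F Gamma_ xbar u -> sum_span_normals F Gamma_ xbar v ->
  sum_span_normals F Gamma_ xbar (c *: u + v).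
Proof.
move=> [mu muN ->] [nu nuN ->]; exists (fun j => c *: mu j + nu j).
  by move=> j aj; apply: linear_spanP; [exact: muN|exact: nuN].
by rewrite scaler_sumr big_split.
Qed.

Lemma normal_sum_span j u : Gamma_ j (F xbar) ->
  regular_normal_cone (Gamma_ j) (F xbar) u ->
  sum_span_normals F Gamma_ xbar u.
Proof.
move=> Gj Nu; exists (fun i => if i == j then u else 0).
  move=> i _; have [->|_] := eqVneq i j; first exact: linear_span_sub.
  exact: linear_span0.
rewrite (bigD1 j)/=; last by rewrite inE.
by rewrite eqxx big1 ?addr0// => i /andP[_ /negbTE->].
Qed.

Lemma cvg_multipliers_LICQ (x_ : nat -> 'rV[R]_n) (u_ : nat -> 'rV[R]_l) y :
  C1_vector F -> LICQ F Gamma_ xbar ->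
  (forall k, sum_span_normals F Gamma_ xbar (u_ k)) ->
  x_ @ \oo --> xbar -> (fun k => jacT_mul F (x_ k) (u_ k)) @ \oo --> y ->
  exists2 u : 'rV[R]_l, u_ @ \oo --> u & jacT_mul F xbar u = y.
Proof.
move=> [_ cJ] [_ inj] Su xx uy.
apply: (@cvg_multipliers _ _ _ _ _ _ (sum_span_normals F Gamma_ xbar) _ _
  (jac F \o x_)) => //.
- exact: sum_span_normals0.
- exact: sum_span_normalsP.
- exact: (cvg_comp _ _ xx (cJ xbar)).
Qed.

End sum_span_normals.

(** * Stationarity *)

(** Approximate multipliers at points [x_ k] tending to [xbar] have images
tending to [- gradient f xbar]; by stability under LICQ they converge. *)
Lemma KKT_active (R : realType) (n l t : nat) (f : 'rV[R]_n -> R)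
    (F : 'rV[R]_n -> 'rV[R]_l) (Gamma_ : 'I_t -> set 'rV[R]_l)
    (xbar : 'rV[R]_n) j :
  C1_scalar f -> C1_vector F -> convex_polyhedral (Gamma_ j) ->
  local_minimizer f F Gamma_ xbar -> LICQ F Gamma_ xbar ->
  Gamma_ j (F xbar) ->
  exists2 u, regular_normal_cone (Gamma_ j) (F xbar) u &
    gradient f xbar + jacT_mul F xbar u = 0.
Proof.
move=> [df cgrad] F1 [m [a [b Gab]]] [_ xmin] licq Gj.
have minj : \forall x \near xbar, Gamma_ j (F x) -> f xbar <= f x.
  by apply: filterS xmin => x + Gx; apply; exists j.
have /choice[w wP] : forall k : nat, exists w : 'rV[R]_n * 'rV[R]_l,
    [/\ `|w.1 - xbar| < harmonic k,
        regular_normal_cone (Gamma_ j) (F xbar) w.2 &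
        gradient f w.1 + jacT_mul F w.1 w.2 = - 2 *: (w.1 - xbar)].
  move=> k; move: Gj minj; rewrite Gab => Gj minj.
  have [x [u H]] := approximate_KKT df F1.1 Gj minj (harmonic_gt0 k).
  by exists (x, u).
have xx : (fst \o w) @ \oo --> xbar.
  apply/cvgrPdist_le => e e0; near=> k; have [wk _ _] := wP k.
  rewrite distrC (le_trans (ltW wk))//.
  rewrite -[leLHS]ger0_norm; last exact: harmonic_ge0.
  by near: k; exact: (cvgr0_norm_le _ cvg_harmonic).
have uy : (fun k => jacT_mul F (w k).1 (w k).2) @ \oo --> - gradient f xbar.
  rewrite (_ : (fun k => _) =
      (fun k => - 2 *: ((w k).1 - xbar) - gradient f (w k).1)); last first.
    by apply/funext => k; have [_ _ <-] := wP k; rewrite addrC addKr.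
  rewrite -[X in _ --> X]add0r -(scaler0 _ (- 2)) -(subrr xbar); apply: cvgB.
    by apply: cvgZ; [exact: cvg_cst|apply: cvgB => //; exact: cvg_cst].
  exact: (cvg_comp _ _ xx (cgrad xbar)).
have Su k : sum_span_normals F Gamma_ xbar (w k).2.
  by have [_ /(normal_sum_span Gj)] := wP k.
have [u uu ju] := cvg_multipliers_LICQ F1 licq Su xx uy.
exists u; last by rewrite ju subrr.
by apply: regular_normal_cone_cvg uu => k; have [] := wP k.
Unshelve. all: by end_near. Qed.

Theorem proposition3p16 (R : realType) (n l t : nat)
    (f : 'rV[R]_n -> R) (F : 'rV[R]_n -> 'rV[R]_l)
    (Gamma_ : 'I_t -> set 'rV[R]_l) (xbar : 'rV[R]_n)
    (f_C1 : C1_scalar f) (F_C1 : C1_vector F)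
    (Gamma_polyhedral : forall j, convex_polyhedral (Gamma_ j))
    (xbar_locmin : local_minimizer f F Gamma_ xbar)
    (xbar_LICQ : LICQ F Gamma_ xbar) :
  (SAS_stationary f F Gamma_ xbar /\ AS_regular F Gamma_ xbar) /\
  S_stationary f F Gamma_ xbar.
Proof.
have [feas _] := xbar_LICQ; have [i _ Gi] := feas.
have KKT j :=
  KKT_active f_C1 F_C1 (Gamma_polyhedral j) xbar_locmin xbar_LICQ.
have [u Nu gu] := KKT i Gi.
have NGu : regular_normal_cone (Gamma Gamma_) (F xbar) u.
  apply: regular_normal_cone_bigcup => j; first exact: closed_polyhedral.
  (* LICQ makes the multiplier of any other active piece equal to [u] *)
  move=> Gj; have [v Nv gv] := KKT j Gj.
  suff /eqP : v - u = 0 by rewrite subr_eq0 => /eqP <-.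
  apply: xbar_LICQ.2.
    rewrite /jacT_mul mulmxBl; apply/eqP; rewrite subr_eq0; apply/eqP.
    by apply: (addrI (gradient f xbar)); rewrite gu.
  rewrite addrC -scaleN1r; apply: sum_span_normalsP.
    exact: normal_sum_span Gi Nu.
  exact: normal_sum_span Gj Nv.
split; last by split=> //; exists u.
split; split=> //.
  exists (fun=> xbar), (fun=> u), (fun=> 0); split => //; exact: cvg_cst.
move=> y [x_ [y_ [xx yy xyP]]].
have /choice[u_ uP] : forall k, exists v,
    regular_normal_cone (Gamma Gamma_) (F xbar) v /\
    jacT_mul F (x_ k) v = y_ k.
  by move=> k; have [v Nv vy] := xyP k; exists v.
have Su k : sum_span_normals F Gamma_ xbar (u_ k).
  apply: (normal_sum_span Gi); have [+ _] := uP k.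
  by apply: regular_normal_coneS => z Gz; exists i.
have uy : (fun k => jacT_mul F (x_ k) (u_ k)) @ \oo --> y.
  by rewrite (_ : (fun k => _) = y_)//; apply/funext => k; have [] := uP k.
have [v uv vy] := cvg_multipliers_LICQ F_C1 xbar_LICQ Su xx uy.
by exists v => //; apply: regular_normal_cone_cvg uv => k; have [] := uP k.
Qed.
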